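(* Let $n\ge 5$. The set of all regular elements of $\mathcal{E}_n=\mathrm{End}(\mathcal{T}_n)$ is $\mathcal{G}_n\cup E(\mathcal{E}_n)$, where $\mathcal{G}_n=\mathrm{Aut}(\mathcal{T}_n)$ and $E(\mathcal{E}_n)$ is the set of idempotents of $\mathcal{E}_n$. Furthermore, this is a proper subsemigroup of $\mathcal{E}_n$. In particular, $\mathcal{E}_n$ is not regular.
   Context: $\mathcal{T}_n$ is the full transformation semigroup of all maps $\{1,\dots,n\}\to\{1,\dots,n\}$ under composition. $\mathcal{E}_n=\mathrm{End}(\mathcal{T}_n)$ is the monoid, under composition, of all semigroup endomorphisms of $\mathcal{T}_n$ (not required to fix the identity map), with maps composed left to right; $\mathcal{G}_n=\mathrm{Aut}(\mathcal{T}_n)$ is the group of automorphisms. An element $a$ of a semigroup $S$ is regular if $a=aba$ for some $b\in S$; $S$ is regular if all its elements are. *)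

(* Defs.v *)
From HB Require Import structures.
From mathcomp Require Import all_boot.

Set Implicit Arguments.
Unset Strict Implicit.
Unset Printing Implicit Defensive.

Local Open Scope group_scope.

#[short(type="finSemigroupType")]
HB.structure Definition FinSemigroup := {S of Semigroup S & Finite S}.

Section SemigroupSets.
Variable S : finSemigroupType.

Definition regular_elements : {set S} := [set a | [exists b, a == a * b * a]].

Definition idempotents : {set S} := [set a | a * a == a].

Definition regular_semigroup : Prop := forall a : S, a \in regular_elements.

Definition subsemigroup (A : {set S}) : Prop := A != set0 /\ mulg_closed A.

End SemigroupSets.
Arguments regular_elements : clear implicits.
Arguments idempotents : clear implicits.
Arguments regular_semigroup : clear implicits.

Definition transformation (n : nat) := {ffun 'I_n -> 'I_n}.
Notation "''T_' n" := (transformation n)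
  (at level 0, n at level 2, format "''T_' n").

Section Transformation.
Variable n : nat.

HB.instance Definition _ := Finite.on 'T_n.

(* Maps are composed from left to right: first s, then t *)
Definition tr_mul (s t : 'T_n) : 'T_n := [ffun i => t (s i)].
Definition tr_one : 'T_n := [ffun i => i].

Fact tr_mulA : associative tr_mul.
Proof. by move=> r s t; apply/ffunP=> i; rewrite !ffunE. Qed.
Fact tr_mul1 : left_id tr_one tr_mul.
Proof. by move=> s; apply/ffunP=> i; rewrite !ffunE. Qed.
Fact tr_mulr1 : right_id tr_one tr_mul.
Proof. by move=> s; apply/ffunP=> i; rewrite !ffunE. Qed.

HB.instance Definition _ := isMonoid.Build 'T_n tr_mulA tr_mul1 tr_mulr1.

Lemma trM (s t : 'T_n) i : (s * t) i = t (s i).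
Proof. by rewrite ffunE. Qed.
Lemma tr1 i : (1 : 'T_n) i = i.
Proof. by rewrite ffunE. Qed.

End Transformation.

Section Endomorphisms.
Variable S : finSemigroupType.

(* Stored as graphs with a boolean multiplicativity test, so that
   endomorphisms form a finite type with extensional equality. *)
Record endo := Endo {
  endo_fun :> {ffun S -> S};
  _ : [forall x, forall y, endo_fun (x * y) == endo_fun x * endo_fun y]
}.

HB.instance Definition _ := [isSub for endo_fun].
HB.instance Definition _ := [Finite of endo by <:].

Lemma endoM (f : endo) : {morph f : x y / x * y}.
Proof. by move=> x y; case: f => f /= /forallP/(_ x)/forallP/(_ y)/eqP. Qed.

HB.instance Definition _ (f : endo) := isMultiplicative.Build S S f (endoM f).

Lemma endoP (f g : endo) : f =1 g <-> f = g.
Proof. by split=> [fg | -> //]; apply/val_inj/ffunP. Qed.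

Fact endo_mul_subproof (f g : endo) (h := [ffun x => g (f x)]) :
  [forall x, forall y, h (x * y) == h x * h y].
Proof. by apply/forallP=> x; apply/forallP=> y; rewrite !ffunE !endoM. Qed.
(* Left-to-right composition again *)
Definition endo_mul (f g : endo) : endo := Endo (endo_mul_subproof f g).

Fact endo_one_subproof (h := [ffun x : S => x]) :
  [forall x, forall y, h (x * y) == h x * h y].
Proof. by apply/forallP=> x; apply/forallP=> y; rewrite !ffunE. Qed.
Definition endo_one : endo := Endo endo_one_subproof.

Fact endo_mulA : associative endo_mul.
Proof. by move=> f g h; apply/endoP=> x; rewrite !ffunE. Qed.
Fact endo_mul1 : left_id endo_one endo_mul.
Proof. by move=> f; apply/endoP=> x; rewrite !ffunE. Qed.
Fact endo_mulr1 : right_id endo_one endo_mul.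
Proof. by move=> f; apply/endoP=> x; rewrite !ffunE. Qed.

HB.instance Definition _ :=
  isMonoid.Build endo endo_mulA endo_mul1 endo_mulr1.

Lemma endo_mulE (f g : endo) x : (f * g) x = g (f x).
Proof. by rewrite ffunE. Qed.
Lemma endo_oneE x : (1 : endo) x = x.
Proof. by rewrite ffunE. Qed.

Definition automorphisms : {set endo} :=
  [set f : endo | injectiveb f && [forall y, exists x, f x == y]].

Lemma automorphismsP (f : endo) : reflect (bijective f) (f \in automorphisms).
Proof.
rewrite inE; apply: (iffP andP) => [[/injectiveP f_inj _] | f_bij].
  exact: injF_bij.
split; first exact/injectiveP/bij_inj.
by case: f_bij => g _ gK; apply/forallP=> y; apply/existsP; exists (g y); rewrite gK.
Qed.

End Endomorphisms.
Arguments automorphisms : clear implicits.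

Notation "''E_' n" := (endo 'T_n) (at level 0, n at level 2, format "''E_' n").
Notation "''G_' n" := (automorphisms 'T_n)
  (at level 0, n at level 2, format "''G_' n").

(* Every semigroup morphism, unital or not, is represented in endo. *)
Lemma endo_multiplicative n (f : {multiplicative 'T_n -> 'T_n}) :
  exists g : 'E_n, g =1 f.
Proof.
have fM : [forall x, forall y, [ffun z => f z] (x * y) ==
             [ffun z => f z] x * [ffun z => f z] y].
  by apply/forallP=> x; apply/forallP=> y; rewrite !ffunE gmulfM.
by exists (Endo fM) => x; rewrite /= ffunE.
Qed.

(* Main.v *)
Require Import Defs.
From HB Require Import structures.
From mathcomp Require Import all_boot.
From mathcomp Require Import fingroup perm gseries alt.

(** Endomorphisms of T_n see a transformation through its sign: even
    permutation, odd permutation, or singular (non-injective) map.  For n >= 5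
    an endomorphism f is either an automorphism or constant on each of these
    three classes ([bijective_or_sign_determined]).  The reason is that a
    non-injective f identifies all constant maps, to a common value e which is
    then a zero of the image of f.  Hence f is not injective on S_n: otherwise
    S_n, acting faithfully through f on the image of the idempotent f 1, would
    induce all n! permutations of the n points, although each of them fixes a
    point in the range of e.  The kernel of f on S_n is thus a nontrivial normal
    subgroup and contains the simple group A_n.  Finally all the idempotents
    folding one point onto a fixed y are conjugate under A_n, so have the same
    image; as their product is constant, that image is e, and every singular map
    has such an idempotent as a left factor.

    In either case f induces a map on signs ([endo_tr_sign]), and this reduces
    the rest to one criterion: a sign-determined f is idempotent exactly when
    two values of f with the same sign are equal
    ([separates_image_idempotent], [idempotent_separates_image]).
    If f = f g f and f u, f v have the same sign, so do g (f u) and g (f v),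
    whence f u = f v; thus f is idempotent when it is sign-determined.  The
    criterion also passes to a product when the sign-determined idempotent f is
    multiplied by any endomorphism on the left or by an automorphism on the
    right, which gives closure under products.  An endomorphism with exactly two
    values, both singular, is neither bijective nor idempotent. *)

Set Implicit Arguments.
Unset Strict Implicit.
Unset Printing Implicit Defensive.

Local Open Scope group_scope.

(** * Constants, permutations and signs of transformations *)

Definition tr_const n (i : 'I_n) : 'T_n := [ffun=> i].

Definition perm_tr n (s : 'S_n) : 'T_n := [ffun i => s i].

Lemma mul_tr_const n (i : 'I_n) (x : 'T_n) : tr_const i * x = tr_const (x i).
Proof. by apply/ffunP=> j; rewrite trM !ffunE. Qed.

Lemma tr_mul_const n (i : 'I_n) (x : 'T_n) : x * tr_const i = tr_const i.
Proof. by apply/ffunP=> j; rewrite trM !ffunE. Qed.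

Lemma tr_const_inj n : injective (@tr_const n).
Proof. by move=> i j /ffunP/(_ i); rewrite !ffunE. Qed.

Lemma perm_tr_inj n : injective (@perm_tr n).
Proof. by move=> s t /ffunP st; apply/permP=> i; have:= st i; rewrite !ffunE. Qed.

Lemma perm_trM n : {morph @perm_tr n : s t / s * t}.
Proof. by move=> s t; apply/ffunP=> i; rewrite trM !ffunE permM. Qed.

Lemma perm_tr1 n : perm_tr 1 = 1 :> 'T_n.
Proof. by apply/ffunP=> i; rewrite !ffunE perm1. Qed.

Variant tr_spec n (x : 'T_n) : Prop :=
| PermTr s of x = perm_tr s
| SingularTr i j of i != j & x i = x j.

Lemma trP n (x : 'T_n) : tr_spec x.
Proof.
have [/injectiveP x_inj | /injectivePn[i [j ij xij]]] := boolP (injectiveb x).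
  by apply: (@PermTr _ _ (perm x_inj)); apply/ffunP=> i; rewrite ffunE permE.
exact: SingularTr ij xij.
Qed.

Definition tr_sign n (x : 'T_n) : option bool :=
  omap (@odd_perm _) [pick s | x == perm_tr s].

Lemma tr_sign_perm n (s : 'S_n) : tr_sign (perm_tr s) = Some (odd_perm s).
Proof.
rewrite /tr_sign; case: pickP => [t /eqP/perm_tr_inj -> // | /(_ s)].
by rewrite eqxx.
Qed.

Lemma tr_sign_singular n (x : 'T_n) i j :
  i != j -> x i = x j -> tr_sign x = None.
Proof.
move=> ij xij; rewrite /tr_sign; case: pickP => //= s /eqP xs.
by move: xij ij; rewrite xs !ffunE => /perm_inj ->; rewrite eqxx.
Qed.

Lemma tr_sign_const n (i : 'I_n) : 1 < n -> tr_sign (tr_const i) = None.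
Proof.
move=> n_gt1; pose a := Ordinal (ltnW n_gt1); pose b := Ordinal n_gt1.
by apply: (@tr_sign_singular _ _ a b); rewrite ?ffunE.
Qed.

Lemma tr_sign1 n : tr_sign (1 : 'T_n) = Some false.
Proof. by rewrite -perm_tr1 tr_sign_perm odd_perm1. Qed.

Lemma idempotent_tr n (x : 'T_n) : x * x = x -> x = 1 \/ tr_sign x = None.
Proof.
case: (trP x) => [s -> | i j ij xij _]; last first.
  by right; apply: tr_sign_singular xij.
rewrite -perm_trM => /perm_tr_inj/(canRL (mulKg s)).
by rewrite mulVg => ->; left; apply: perm_tr1.
Qed.

Definition sign_determined n (f : 'E_n) : Prop :=
  forall x y, tr_sign x = tr_sign y -> f x = f y.

Definition sign_separates_image n (f : 'E_n) : Prop :=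
  forall x y, tr_sign (f x) = tr_sign (f y) -> f x = f y.

(** * Automorphisms preserve signs *)

(** The constants are the right zeros of T_n, a notion that surjective
    endomorphisms preserve. *)
Lemma auto_fix_const n (f : 'E_n) : bijective f ->
  forall i, exists j, f (tr_const i) = tr_const j.
Proof.
move=> f_bij i; case: (f_bij) => g fK gK; exists (f (tr_const i) i).
by rewrite -mul_tr_const -{2}(gK (tr_const i)) -endoM tr_mul_const.
Qed.

(** The permutation [s] of the points induced on the constants conjugates [x]
    into [f x], and conjugation preserves singularity and parity. *)
Lemma auto_tr_sign n (f : 'E_n) : bijective f ->
  forall x, tr_sign (f x) = tr_sign x.
Proof.
move=> f_bij; have f_inj := bij_inj f_bij.
pose s i := f (tr_const i) i.
have fs i : f (tr_const i) = tr_const (s i).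
  by have [j fi] := auto_fix_const f_bij i; rewrite /s fi ffunE.
have s_inj : injective s.
  by move=> i j sij; apply/tr_const_inj/f_inj; rewrite !fs sij.
have fE x i : f x (s i) = s (x i).
  by apply: tr_const_inj; rewrite -fs -(mul_tr_const i) endoM fs mul_tr_const.
move=> x; case: (trP x) => [p -> | i j ij xij]; last first.
  rewrite (tr_sign_singular ij xij) (@tr_sign_singular _ _ (s i) (s j)) //.
    by rewrite (inj_eq s_inj).
  by rewrite !fE xij.
suff -> : f (perm_tr p) = perm_tr (p ^ perm s_inj).
  by rewrite !tr_sign_perm odd_permJ.
apply/ffunP=> k; have [t sK tK] := injF_bij s_inj.
by rewrite -(tK k) fE !ffunE -(permE s_inj (t k)) permJ permE.
Qed.

(** * Non-injective endomorphisms on permutations *)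

(** The constant at [a] times [x] is the constant at [x a], so a suitable [x]
    carries [a] and [b] to any [c] and [d]. *)
Lemma endo_const_collapse n (f : 'E_n) (a b : 'I_n) :
  a != b -> f (tr_const a) = f (tr_const b) ->
  forall c d, f (tr_const c) = f (tr_const d).
Proof.
move=> ab fab c d.
pose x : 'T_n := [ffun i => if i == a then c else d].
have /= := congr1 (fun z => z * f x) fab; rewrite -!endoM.
rewrite !mul_tr_const !ffunE eqxx.
by rewrite eq_sym (negPf ab).
Qed.

Lemma collapsed_const_mull n (f : 'E_n) (e : 'T_n) x :
  0 < n -> (forall c, f (tr_const c) = e) -> e * f x = e.
Proof.
move=> n_gt0 fe.
by rewrite -(fe (Ordinal n_gt0)) -endoM mul_tr_const !fe.
Qed.

(** The permutations [f s] restrict to on the image of the idempotent [f 1],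
    extended by the identity, all fix the points in the range of [e]; being
    fewer than n!, they cannot be distinct. *)
Lemma collapsed_not_inj_perm n (f : 'E_n) (e : 'T_n) :
  1 < n -> (forall c, f (tr_const c) = e) ->
  exists2 s : 'S_n, s != 1 & f (perm_tr s) = f 1.
Proof.
move=> n_gt1 fe; have n_gt0 := ltnW n_gt1.
pose o : 'I_n := Ordinal n_gt0; pose p := e o.
have fp x : f x p = p.
  by rewrite /p -trM (collapsed_const_mull _ n_gt0 fe).
pose A := [set f 1 i | i : 'I_n].
have A1 i : i \in A -> f 1 i = i.
  by case/imsetP=> j _ ->; rewrite -trM -endoM mul1g.
have fA x i : f x i \in A.
  by apply/imsetP; exists (f x i) => //; rewrite -trM -endoM mulg1.
(* [f (perm_tr s)] permutes [A] and is determined by its restriction to it,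
   because [f x = f 1 * f x]. *)
pose r (s : 'S_n) i := if i \in A then f (perm_tr s) i else i.
have rA s i : (r s i \in A) = (i \in A).
  by rewrite /r; case: ifP => [_|->//]; rewrite fA.
have rK s t i : s * t = 1 -> r t (r s i) = i.
  move=> st1; rewrite /r; have [iA | iA] := boolP (i \in A).
    by rewrite fA -trM -endoM -perm_trM st1 perm_tr1 A1.
  by rewrite (negPf iA).
have r_inj s : injective (r s).
  by apply: (can_inj (g := r s^-1)) => i; rewrite rK ?mulgV.
pose R s := perm (r_inj s).
have Rp s : R s p = p.
  by rewrite permE /r fp if_same.
have R_not_inj : ~~ injectiveb R.
  apply/negP=> /injectiveP/injF_bij[R' _ R'K].
  pose q : 'I_n := Ordinal n_gt1.
  have := Rp (R' (tperm p (if p == o then q else o))).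
  (* The transposition moves [p], so it is not of the form [R s]. *)
  rewrite R'K tpermL; case: eqP => [-> // | po op].
  by case: po.
have /injectivePn[s [t st Rst]] := R_not_inj.
have fst : f (perm_tr s) = f (perm_tr t).
  apply/ffunP=> i.
  have f1 x : f x i = f x (f 1 i) by rewrite -trM -endoM mul1g.
  have := congr1 (fun u : 'S_n => u (f 1 i)) Rst.
  by rewrite /= !permE /r fA -!f1.
exists (s * t^-1); first by rewrite -(inj_eq (mulIg t)) mulgKV mul1g.
by rewrite perm_trM endoM fst -endoM -perm_trM mulgV perm_tr1.
Qed.

Lemma perm_center_trivial n (s : 'S_n) :
  2 < n -> s != 1 -> exists t, s * t != t * s.
Proof.
move=> n_gt2 s1.
have [a sa] : exists a, s a != a.
  apply/existsP; apply: contraR s1 => /existsPn s_id.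
  by apply/eqP/permP=> a; rewrite perm1; apply/eqP/negPn/s_id.
have [c] : exists c, c \notin [set a; s a].
  apply/existsP; rewrite -negb_forall; apply/negP=> /forallP all_ab.
  have : #|[set a; s a]| = n.
    rewrite -[RHS]card_ord -cardsT; congr #|pred_of_set _|.
    by apply/setP=> i; rewrite all_ab inE.
  by move=> c2; move: (cards2 a (s a)) n_gt2; rewrite c2 => ->; case: (_ != _).
rewrite !inE negb_or => /andP[ca csa].
(* The transposition fixes [a] but moves [s a]. *)
exists (tperm (s a) c); apply/eqP=> /permP/(_ a).
by rewrite !permM tpermL tpermD // => /eqP; rewrite (negPf csa).
Qed.

(** By simplicity it is enough that [K] meets the alternating group
    nontrivially: it contains the commutators of its elements with arbitrary
    permutations, which are even and, as the centre of S_n is trivial, not all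
    equal to [1]. *)
Lemma Alt_sub_normal n (K : {group 'S_n}) :
  4 < n -> 'Sym_('I_n) \subset 'N(K) -> K :!=: 1 -> 'Alt_('I_n) \subset K.
Proof.
move=> n_gt4 nK K1.
have /simpleP[_ simpleA] : simple 'Alt_('I_n).
  by apply: simple_Alt5; rewrite card_ord.
have nKA : K :&: 'Alt_('I_n) <| 'Alt_('I_n).
  rewrite /normal subsetIr normsI ?normG //.
  exact: subset_trans (Alt_subset _) nK.
case: (simpleA _ nKA) => [KA1 | KA]; last by rewrite -KA subsetIl.
have [s sK s1] : exists2 s, s \in K & s != 1 by apply/trivgPn.
have [t /eqP[]] := perm_center_trivial (ltnW (ltnW n_gt4)) s1.
apply/commgP; suff : [~ s, t] \in K :&: 'Alt_('I_n) by rewrite KA1 inE.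
rewrite inE Alt_even commgEl groupM ?groupV ?memJ_norm ?(subsetP nK) ?inE //=.
by rewrite odd_permM odd_permV odd_permJ addbb.
Qed.

Lemma collapsed_even n (f : 'E_n) (e : 'T_n) :
  4 < n -> (forall c, f (tr_const c) = e) ->
  forall s : 'S_n, ~~ odd_perm s -> f (perm_tr s) = f 1.
Proof.
move=> n_gt4 fe s s_even.
pose K := [set s : 'S_n | f (perm_tr s) == f 1].
have gK : group_set K.
  apply/group_setP; split=> [|u v]; first by rewrite inE perm_tr1.
  rewrite !inE perm_trM endoM => /eqP-> /eqP->.
  by rewrite -endoM mulg1.
have nK : 'Sym_('I_n) \subset 'N(Group gK).
  apply/subsetP=> t _; rewrite inE; apply/subsetP=> _ /imsetP[u uK ->].
  move: uK; rewrite /= !inE conjgE !perm_trM !endoM => /eqP ->.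
  by rewrite -!endoM mul1g -perm_trM mulVg perm_tr1.
have K1 : Group gK :!=: 1.
  have [u u1 fu] := collapsed_not_inj_perm (ltnW (ltnW (ltnW n_gt4))) fe.
  by apply/trivgPn; exists u; rewrite // inE fu.
have /subsetP/(_ s) := Alt_sub_normal n_gt4 nK K1.
by rewrite Alt_even inE => /(_ s_even)/eqP.
Qed.

(** * Non-injective endomorphisms on singular maps *)

Definition fold_tr n (x y : 'I_n) : 'T_n := [ffun i => if i == x then y else i].

(** Swapping the two spare points corrects the parity of a permutation without
    disturbing [x], [y] and [z]; this uses n >= 5. *)
Lemma card_avoid3 n (x y z : 'I_n) : 4 < n ->
  exists u v, [/\ u != v, u \notin [set x; y; z] & v \notin [set x; y; z]].
Proof.
move=> n_gt4.
have : 1 < #|~: [set x; y; z]|.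
  have := cardsC [set x; y; z]; rewrite card_ord => cn.
  have c3 : #|[set x; y; z]| <= 3.
    rewrite -[[set x; y; z]]setUC cardsU1 cards2.
    by case: (z \notin _); case: (x != y).
  rewrite -(ltn_add2l #|[set x; y; z]|) cn; apply: leq_trans n_gt4.
  by rewrite addn1 !ltnS.
by case/card_gt1P=> u [v []]; rewrite !in_setC => ux vx uv; exists u, v.
Qed.

(** The folds onto [y] are conjugate under even permutations, so share their
    value [d], an idempotent; the constant map at [y] is the product of all of
    them, so its value [e] is a power of [d], that is [d] itself. *)
Lemma collapsed_fold n (f : 'E_n) (e : 'T_n) :
  4 < n -> (forall c, f (tr_const c) = e) ->
  forall x y, x != y -> f (fold_tr x y) = e.
Proof.
move=> n_gt4 fe x y xy; have n_gt0 : 0 < n by exact: leq_trans n_gt4.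
have f_even := collapsed_even n_gt4 fe.
have f_fold x' : x' != y -> f (fold_tr x' y) = f (fold_tr x y).
  move=> x'y; have [-> // | xx'] := eqVneq x' x.
  have [u [v [uv]]] := card_avoid3 x x' y n_gt4.
  rewrite !inE !negb_or => /andP[/andP[ux ux'] uy] /andP[/andP[vx vx'] vy].
  pose s := tperm x x' * tperm u v.
  have fs : f (perm_tr s) = f 1.
    by apply: f_even; rewrite odd_permM !odd_tperm uv eq_sym xx'.
  have sE : perm_tr s * fold_tr x y = fold_tr x' y * perm_tr s.
    apply/ffunP=> i; rewrite !trM !ffunE !permM.
    have sy : tperm u v (tperm x x' y) = y.
      by rewrite tpermD // tpermD.
    have [-> | ix'] := eqVneq i x'.
      by rewrite tpermR tpermD // eqxx sy.
    case: eqVneq => // six; move: ix'.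
    rewrite -(inj_eq (@perm_inj _ (tperm x x'))).
    by rewrite tpermR -(inj_eq (@perm_inj _ (tperm u v))) six tpermD ?eqxx.
  have := congr1 f sE; rewrite !endoM fs.
  by rewrite -!endoM mulg1 mul1g.
pose d := f (fold_tr x y).
(* [c l] folds all points of [l] onto [y]: it interpolates between the identity
   and the constant at [y]. *)
pose c (l : seq 'I_n) : 'T_n := [ffun i => if i \in l then y else i].
have dc l : y \notin l -> d * f (c l) = d.
  elim: l => [|x' l IHl] yl.
    have -> : c [::] = 1 by apply/ffunP=> i; rewrite !ffunE.
    by rewrite /d -endoM mulg1.
  move: yl; rewrite inE negb_or eq_sym => /andP[x'y yl].
  have -> : c (x' :: l) = fold_tr x' y * c l.
    apply/ffunP=> i; rewrite trM !ffunE inE; case: eqVneq => //= _.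
    by rewrite (negPf yl).
  rewrite endoM (f_fold _ x'y) mulgA -/d.
  have -> : d * d = d; last exact: IHl.
  rewrite /d -endoM; congr (f _); apply/ffunP=> i; rewrite trM !ffunE.
  case: (eqVneq i x) => [_ | /negPf-> //].
  by rewrite eq_sym (negPf xy).
rewrite -/d -(dc [seq i <- enum 'I_n | i != y]); last by rewrite mem_filter eqxx.
have -> : c [seq i <- enum 'I_n | i != y] = tr_const y.
  by apply/ffunP=> i; rewrite !ffunE mem_filter mem_enum andbT; case: eqVneq.
by rewrite fe /d -(fe y) -endoM tr_mul_const.
Qed.

(** A singular map [z] with [z a = z b] factors as [fold_tr a b * z], so has
    value [e]; permutations of equal parity differ by an even factor, which a
    non-injective [f] does not see. *)
Lemma bijective_or_sign_determined n (f : 'E_n) :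
  4 < n -> bijective f \/ sign_determined f.
Proof.
move=> n_gt4; have n_gt0 : 0 < n by exact: leq_trans n_gt4.
have [/injectiveP/injF_bij | /injectivePn[x [y]]] := boolP (injectiveb f).
  by left.
move=> xy fxy; right.
have [i xyi] : exists i, x i != y i.
  apply/existsP; apply: contraR xy => /existsPn eqxy.
  by apply/eqP/ffunP=> i; apply/eqP/negPn/eqxy.
pose e := f (tr_const (Ordinal n_gt0)).
have fe c : f (tr_const c) = e.
  by apply: (endo_const_collapse xyi); rewrite -!mul_tr_const !endoM fxy.
have f_even := collapsed_even n_gt4 fe.
have f_sing z : tr_sign z = None -> f z = e.
  case: (trP z) => [s -> | a b ab zab _]; first by rewrite tr_sign_perm.
  suff -> : z = fold_tr a b * z.
    by rewrite endoM (collapsed_fold n_gt4 fe ab) (collapsed_const_mull _ n_gt0 fe).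
  by apply/ffunP=> j; rewrite trM !ffunE; case: eqVneq => // ->.
move=> u v uv; case: (trP u) (trP v) => [s us | a b ab uab].
  case=> [t vt | a b ab vab]; last first.
    by move: uv; rewrite us tr_sign_perm (tr_sign_singular ab vab).
  move: uv; rewrite us vt !tr_sign_perm => -[st].
  rewrite -[s](mulgKV t) perm_trM endoM f_even.
    by rewrite -endoM mul1g.
  by rewrite odd_permM odd_permV st addbb.
by move=> _; rewrite !f_sing // -?uv (tr_sign_singular ab uab).
Qed.

(** * Idempotents and regular endomorphisms *)

Lemma endo_tr_sign n (f : 'E_n) x y : 4 < n ->
  tr_sign x = tr_sign y -> tr_sign (f x) = tr_sign (f y).
Proof.
move=> n_gt4 xy; case: (bijective_or_sign_determined f n_gt4) => [f_bij | fS].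
  by rewrite !auto_tr_sign.
by rewrite (fS _ _ xy).
Qed.

(** The image consists of [f 1] and its zero [e], both idempotent, and the
    common value of odd permutations.  An idempotent is [1] or singular, so
    separation forces, unless [f] is constant, [f 1 = 1] and [e] singular, both
    fixed by [f].  A third value has the only remaining sign, odd, and is fixed
    too. *)
Lemma separates_image_idempotent n (f : 'E_n) : 1 < n ->
  sign_determined f -> sign_separates_image f -> f * f = f.
Proof.
move=> n_gt1 fS f_sep; apply/endoP=> x; rewrite endo_mulE.
pose c : 'T_n := tr_const (Ordinal (ltnW n_gt1)).
have sc : tr_sign c = None by apply: tr_sign_const.
pose e := f c.
have eM y : e * f y = e.
  apply: collapsed_const_mull => [|i]; first exact: ltnW.
  by apply: fS; rewrite sc tr_sign_const.
have e_idem : e * e = e by apply: eM.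
case: (idempotent_tr e_idem) => [e1 | e_sing].
  have f_const y : f y = e by rewrite -[f y]mul1g -e1 eM.
  by rewrite !f_const.
have fe : f e = e by apply: fS; rewrite e_sing.
have f1_idem : f 1 * f 1 = f 1 by rewrite -endoM mulg1.
case: (idempotent_tr f1_idem) => [f1 | f1_sing]; last first.
  have f1e : f 1 = e by apply: f_sep; rewrite f1_sing e_sing.
  have f_const y : f y = e by rewrite -[y]mul1g endoM f1e eM.
  by rewrite !f_const.
case fx: (tr_sign (f x)) => [[]|]; first 1 last.
- have fx1 : f x = 1 by rewrite -f1; apply: f_sep; rewrite f1 fx tr_sign1.
  by rewrite fx1.
- by have -> : f x = e by apply: f_sep; rewrite fx e_sing.
case sx: (tr_sign x) => [[]|].
- by apply: fS; rewrite fx.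
- have fx1 : f x = 1 by rewrite -f1; apply: fS; rewrite sx tr_sign1.
  by rewrite fx1.
have fxe : f x = e by apply: fS; rewrite sx sc.
by rewrite fxe.
Qed.

Lemma idempotent_separates_image n (f : 'E_n) :
  sign_determined f -> f * f = f -> sign_separates_image f.
Proof.
by move=> fS ff x y /fS; rewrite -!endo_mulE ff.
Qed.

Lemma regular_determined_idempotent n (f g : 'E_n) : 4 < n ->
  sign_determined f -> f = f * g * f -> f * f = f.
Proof.
move=> n_gt4 fS fgf.
apply: separates_image_idempotent => //; first exact: leq_trans n_gt4.
move=> x y fxy; rewrite fgf !endo_mulE.
exact/fS/endo_tr_sign.
Qed.

(** Left multiplication by [f] is injective on the finite monoid of
    endomorphisms since [f] is surjective, so it reaches [1]. *)
Lemma auto_regular (S : finSemigroupType) (f : endo S) :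
  f \in automorphisms S -> f \in regular_elements (endo S).
Proof.
move/automorphismsP=> -[h fK hK].
have mulf_inj : injective (fun g : endo S => f * g).
  move=> g g' /endoP gg'; apply/endoP=> x.
  by have := gg' (h x); rewrite !endo_mulE hK.
have [g' _ g'K] := injF_bij mulf_inj.
by rewrite inE; apply/existsP; exists (g' 1); rewrite (g'K 1) mul1g.
Qed.

Lemma regular_elements_endo n : 4 < n ->
  regular_elements 'E_n = 'G_n :|: idempotents 'E_n.
Proof.
move=> n_gt4; apply/setP=> f; rewrite in_setU.
apply/idP/orP=> [|[]].
- rewrite inE => /existsP[g /eqP fgf].
  case: (bijective_or_sign_determined f n_gt4) => [/automorphismsP-> | fS].
    by left.
  by right; rewrite inE; apply/eqP/(regular_determined_idempotent n_gt4 fS fgf).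
- exact: auto_regular.
rewrite !inE => /eqP ff; apply/existsP; exists f.
by rewrite !ff.
Qed.

(** If [g] is a sign-determined idempotent, so is [f * g] for any [f], its image
    lying in that of [g]; if [g] is an automorphism, it preserves signs, so
    [f * g] separates its image as soon as [f] does. *)
Lemma auto_or_idempotent_mul_closed n : 4 < n ->
  mulg_closed ('G_n :|: idempotents 'E_n).
Proof.
move=> n_gt4 f g.
have n_gt1 : 1 < n by exact: leq_trans n_gt4.
have cases h : h \in 'G_n :|: idempotents 'E_n ->
    h \in 'G_n \/ sign_determined h /\ h * h = h.
  rewrite in_setU => /orP[|]; first by left.
  rewrite inE => /eqP hh.
  case: (bijective_or_sign_determined h n_gt4) => [/automorphismsP-> | hS].
    by left.
  by right.
move=> /cases f_or /cases[gG | [gS gg]]; rewrite in_setU; last first.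
  apply/orP; right; rewrite inE; apply/eqP/separates_image_idempotent => //.
    by move=> x y xy; rewrite !endo_mulE; apply/gS/endo_tr_sign.
  by move=> x y; rewrite !endo_mulE; apply: idempotent_separates_image.
have /automorphismsP g_bij := gG.
case: f_or => [/automorphismsP f_bij | [fS ff]]; apply/orP; [left | right].
  apply/automorphismsP/(eq_bij (bij_comp g_bij f_bij)) => x.
  by rewrite /= endo_mulE.
rewrite inE; apply/eqP/separates_image_idempotent => //.
  by move=> x y /fS fxy; rewrite !endo_mulE fxy.
move=> x y; rewrite !endo_mulE !(auto_tr_sign g_bij).
by move/(idempotent_separates_image fS ff)->.
Qed.

(** * Endomorphisms that are not regular *)

Lemma tr_signM_isSome n (x y : 'T_n) :
  isSome (tr_sign (x * y)) = isSome (tr_sign x) && isSome (tr_sign y).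
Proof.
case: (trP x) => [s -> | i j ij xij]; last first.
  rewrite (tr_sign_singular ij xij) (tr_sign_singular ij) //.
  by rewrite !trM xij.
case: (trP y) => [t -> | i j ij yij]; first by rewrite -perm_trM !tr_sign_perm.
rewrite (tr_sign_singular ij yij) andbF (@tr_sign_singular _ _ (s^-1 i) (s^-1 j)) //.
  by rewrite (inj_eq perm_inj).
by rewrite !trM !ffunE !permKV.
Qed.

(** Sending permutations to [t] and singular maps to [e], for distinct commuting
    singular idempotents [t] and [e = t * e], gives an endomorphism which is not
    constant although its square is. *)
Lemma exists_nonregular_endo n : 2 < n ->
  exists f : 'E_n, f \notin 'G_n :|: idempotents 'E_n.
Proof.
move=> n_gt2.
pose a := Ordinal (ltnW (ltnW n_gt2)); pose b := Ordinal (ltnW n_gt2).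
pose c := Ordinal n_gt2.
pose e := tr_const a; pose t : 'T_n := [ffun i => if i == a then a else b].
have te : t * e = e by apply: tr_mul_const.
have et : e * t = e by rewrite mul_tr_const ffunE eqxx.
have ee : e * e = e by apply: tr_mul_const.
have tt : t * t = t.
  by apply/ffunP=> i; rewrite trM !ffunE; case: (i == a).
have e_sing : tr_sign e = None by rewrite tr_sign_const // ltnW.
have t_sing : tr_sign t = None by apply: (@tr_sign_singular _ _ b c); rewrite ?ffunE.
have t_neq_e : t != e by apply/eqP=> /ffunP/(_ b); rewrite !ffunE.
pose F : {ffun 'T_n -> 'T_n} := [ffun x => if isSome (tr_sign x) then t else e].
have FM : [forall x, forall y, F (x * y) == F x * F y].
  apply/forallP=> x; apply/forallP=> y; rewrite !ffunE tr_signM_isSome.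
  by case: (isSome _); case: (isSome _); rewrite /= ?tt ?te ?et ?ee.
exists (Endo FM); rewrite in_setU negb_or; apply/andP; split.
  apply/automorphismsP=> /bij_inj F_inj.
  by case/eqP: t_neq_e; apply: F_inj; rewrite /= !ffunE t_sing e_sing.
rewrite inE; apply/eqP=> /endoP/(_ 1); rewrite endo_mulE /= !ffunE tr_sign1 /=.
by rewrite t_sing => /esym/eqP; rewrite (negPf t_neq_e).
Qed.

Theorem proposition3p5 (n : nat) (hn : 5 <= n) :
  [/\ regular_elements 'E_n = 'G_n :|: idempotents 'E_n,
      subsemigroup ('G_n :|: idempotents 'E_n),
      'G_n :|: idempotents 'E_n \proper [set: 'E_n]
    & ~ regular_semigroup 'E_n].
Proof.
have [f f_notin] : exists f : 'E_n, f \notin 'G_n :|: idempotents 'E_n.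
  exact/exists_nonregular_endo/ltnW/ltnW.
split.
- exact: regular_elements_endo.
- split; last exact: auto_or_idempotent_mul_closed.
  by apply/set0Pn; exists 1; rewrite !inE mul1g eqxx orbT.
- by rewrite properEneq subsetT andbT; apply: contraNneq f_notin => ->; rewrite inE.
- by move/(_ f); rewrite regular_elements_endo // (negPf f_notin).
Qed.
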